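(* Let $E$ be a Banach lattice. The following hold. (i) $\text{r-o-MW}(E)$ is a subalgebra of $\mathrm{L}_r(E)$. Moreover, $\text{r-o-MW}(E)=\mathrm{L}_r(E)$ if and only if the identity operator $I_E$ belongs to $\text{o-MW}(E)$. (ii) If $E$ is Dedekind complete, then $(\text{r-o-MW}(E),\|\cdot\|_{\text{r-o-MW}})$ is a closed Riesz subalgebra and an order ideal of $(\mathrm{L}_r(E),\|\cdot\|_r)$.
   Context: Vector spaces are real and operators are linear. A sequence $(x_n)$ in a Banach lattice is disjoint if $|x_n|\wedge|x_m|=0$ for $n\neq m$. A bounded operator $T:E\to F$ between Banach lattices is order MW (o-MW) if $f_n(Tx_n)\to0$ for every disjoint bounded sequence $(x_n)$ in $E$ and every order bounded sequence $(f_n)$ in $F'$. $\text{o-MW}(E)$ is the set of o-MW-operators $E\to E$. An operator $T:E\to E$ is a regularly o-MW-operator, $T\in\text{r-o-MW}(E)$, if $T=T_1-T_2$ with $T_1,T_2$ positive o-MW-operators. $\mathrm{L}_r(E)$ is the space of regular operators on $E$ (differences of two positive operators), with composition as multiplication, the order $S\le T$ iff $T-S$ is positive, and the regular norm $\|T\|_r=\inf\{\|S\|:\pm T\le S\}$ (equal to $\|\,|T|\,\|$ when $E$ is Dedekind complete). The norm on $\text{r-o-MW}(E)$ is $\|T\|_{\text{r-o-MW}}=\inf\{\|S\|:\pm T\le S\in\text{o-MW}(E)\}$. A Riesz subalgebra is a subalgebra that is also a vector sublattice. *)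

(* Defs.v *)
From HB Require Import structures.
From mathcomp Require Import all_boot all_order all_algebra.
From mathcomp Require Import all_classical all_reals all_analysis.

Set Implicit Arguments.
Unset Strict Implicit.
Unset Printing Implicit Defensive.

Import Order.TTheory GRing.Theory Num.Theory.
Import numFieldNormedType.Exports.

Local Open Scope classical_set_scope.
Local Open Scope ring_scope.

(* `|x| is always the norm; the lattice modulus is labs below. Order and lattice
   operations are fields of the mixin, because a structure inheriting from both
   NormedModule and Order.Lattice would have to precede numDomainType. The
   canonical order structures are recovered by the instances that follow. *)
HB.mixin Record isBanachLattice (R : realType) E
    of CompleteNormedModule R E := {
  blat_le : rel E;
  blat_meet : E -> E -> E;
  blat_join : E -> E -> E;
  blat_le_refl : reflexive blat_le;
  blat_le_anti : antisymmetric blat_le;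
  blat_le_trans : transitive blat_le;
  blat_meetP : forall x y z : E,
    blat_le x (blat_meet y z) = blat_le x y && blat_le x z;
  blat_joinP : forall x y z : E,
    blat_le (blat_join x y) z = blat_le x z && blat_le y z;
  blat_leD2r : forall z x y : E, blat_le x y -> blat_le (x + z) (y + z);
  blat_leZ2l : forall (a : R) (x y : E),
    0 <= a -> blat_le x y -> blat_le (a *: x) (a *: y);
  blat_norm_le : forall x y : E,
    blat_le (blat_join x (- x)) (blat_join y (- y)) -> `|x| <= `|y|
}.

#[short(type="banachLatticeType")]
HB.structure Definition BanachLattice (R : realType) :=
  {E of isBanachLattice R E & CompleteNormedModule R E}.

HB.instance Definition _ (R : realType) (E : banachLatticeType R) :=
  Order.Le_isPOrder.Build ring_display (BanachLattice.sort E)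
    (@blat_le_refl R E) (@blat_le_anti R E) (@blat_le_trans R E).

HB.instance Definition _ (R : realType) (E : banachLatticeType R) :=
  Order.POrder_MeetJoin_isLattice.Build ring_display (BanachLattice.sort E)
    (@blat_meetP R E) (@blat_joinP R E).

Section banach_lattice.
Variables (R : realType) (E : banachLatticeType R).

Definition labs (x : E) : E := Order.join x (- x).

Definition disjoint_seq (x : nat -> E) : Prop :=
  forall n m, n <> m -> Order.meet (labs (x n)) (labs (x m)) = 0.

Definition dedekind_complete : Prop :=
  forall A : set E, has_sup A -> supremums A !=set0.

End banach_lattice.

Definition bounded_operator (R : realType) (V W : normedModType R) :
    set (V -> W) :=
  [set T | linear T /\ exists M : R, forall x, `|T x| <= M * `|x|].

(* Only meaningful for linear maps. *)
Definition positive (V W : porderZmodType) (T : V -> W) : Prop :=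
  forall x, 0 <= x -> 0 <= T x.

Definition op_le (V W : porderZmodType) (S T : V -> W) : Prop :=
  positive (T - S).

Definition opnorm (R : realType) (V W : normedModType R) (T : V -> W) : R :=
  sup [set `|T x| | x in [set x | `|x| <= 1]].

Definition dual (R : realType) (F : banachLatticeType R) : set (F -> R) :=
  bounded_operator (V := F) (W := R).

Definition dual_order_bounded (R : realType) (F : banachLatticeType R)
    (f : nat -> F -> R) : Prop :=
  (forall n, dual (f n)) /\
  exists g h : F -> R,
    [/\ dual g, dual h & forall n, op_le g (f n) /\ op_le (f n) h].

Definition oMW (R : realType) (E F : banachLatticeType R) : set (E -> F) :=
  [set T | bounded_operator T /\
    forall (x : nat -> E) (f : nat -> F -> R),
      disjoint_seq x -> bounded_fun x -> dual_order_bounded f ->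
      (fun n => f n (T (x n))) @ \oo --> (0 : R)].

Section operators_on_E.
Variables (R : realType) (E : banachLatticeType R).
Implicit Types (S T M : E -> E) (A B : set (E -> E)) (N : (E -> E) -> R).

Definition Lr : set (E -> E) :=
  [set T | exists T1 T2, [/\ linear T1, linear T2, positive T1, positive T2
                           & T = T1 - T2]].

Definition roMW : set (E -> E) :=
  [set T | exists T1 T2, [/\ oMW T1, oMW T2, positive T1, positive T2
                           & T = T1 - T2]].

Definition dominated_norm B T : R :=
  inf [set opnorm S | S in [set S | [/\ B S, op_le T S & op_le (- T) S]]].

Definition r_norm : (E -> E) -> R := dominated_norm Lr.

Definition roMW_norm : (E -> E) -> R := dominated_norm (@oMW R E E).

Definition subspace_of B A : Prop :=
  [/\ A `<=` B, A 0 & forall (a : R) S T, A S -> A T -> A (a *: S + T)].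

(* Not required to contain the identity operator. *)
Definition subalgebra_of B A : Prop :=
  subspace_of B A /\ forall S T, A S -> A T -> A (S \o T).

Definition is_join_in B S T M : Prop :=
  [/\ B M, op_le S M, op_le T M
    & forall U, B U -> op_le S U -> op_le T U -> op_le M U].

Definition is_meet_in B S T M : Prop :=
  [/\ B M, op_le M S, op_le M T
    & forall U, B U -> op_le U S -> op_le U T -> op_le U M].

Definition is_modulus_in B T M : Prop := is_join_in B T (- T) M.

Definition lattice_ordered B : Prop :=
  forall S T, B S -> B T ->
    (exists M, is_join_in B S T M) /\ (exists M, is_meet_in B S T M).

(* The lattice operations are those of the ambient space B. *)
Definition sublattice_of B A : Prop :=
  lattice_ordered B /\
  forall S T M, A S -> A T -> is_join_in B S T M \/ is_meet_in B S T M -> A M.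

Definition riesz_subalgebra_of B A : Prop :=
  subalgebra_of B A /\ sublattice_of B A.

Definition order_ideal_of B A : Prop :=
  [/\ lattice_ordered B, subspace_of B A
    & forall S T MS MT, B S -> A T ->
        is_modulus_in B S MS -> is_modulus_in B T MT -> op_le MS MT -> A S].

Definition norm_closed_in B N A : Prop :=
  forall T, B T -> (forall e : R, 0 < e -> exists2 S, A S & N (T - S) < e) ->
    A T.

End operators_on_E.

Arguments Lr {R} E.
Arguments roMW {R} E.

(* Main.v *)
Require Import Defs.
From mathcomp Require Import all_boot all_order all_algebra.
From mathcomp Require Import all_classical all_reals all_analysis.
From mathcomp Require Import lra.

Import Order.TTheory GRing.Theory Num.Theory.
Import numFieldNormedType.Exports.

Set Implicit Arguments.
Unset Strict Implicit.
Unset Printing Implicit Defensive.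

Local Open Scope classical_set_scope.
Local Open Scope ring_scope.

(** Everything rests on a domination property: if [0 <= S <= T] and [T] is an
    o-MW-operator, then so is [S] ([oMW_domination]). Indeed an order bounded
    sequence of functionals lies between [- g] and [g] for one positive
    functional [g], since the dual is a lattice; so
    [`|f n (S (x n))| <= g (S |x n|) <= g (T |x n|)], and the right-hand side
    tends to [0] because [(|x n|)] is again disjoint and bounded and the
    constant sequence [g] is order bounded.

    The adjoint of a positive operator preserves order bounded
    sequences of functionals, so o-MW-operators are stable under composition on
    the left with positive operators ([oMW_comp]); this gives the algebra
    property, and it turns [idfun] being o-MW into every positive operator
    being o-MW. It uses that positive operators are automatically bounded
    ([positive_bounded]).

    Dedekind completeness makes the regular operators a lattice by
    the Riesz-Kantorovich formula, proved below for a target that is any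
    vector space with a compatible partial order, so that it also yields
    positive majorants of functionals. If [S = S1 - S2] and [T = T1 - T2] with
    positive o-MW parts and [M] is their join, then
    [0 <= M - S <= T1 + S2], so [M - S] and hence [M] is regularly o-MW by
    domination; meets and the ideal property are handled by the same device.

    For closedness, let [S = S1 - S2] be close to [T] and let [U] be a regular
    operator of small norm with [- U <= T - S <= U]. Then [T <= S1 + U], so the
    positive part of [T] is below [S1 + U]; tested on a functional and a
    disjoint sequence, the first term vanishes in the limit and the second is
    uniformly small ([oMW_approx]). The negative part is symmetric. Finally the
    modulus of [T] is an o-MW-operator below every dominator of [T], so both
    norms of [T] equal the operator norm of its modulus. *)

(** * Order and norm in a Banach lattice *)

Section BanachLatticeTheory.
Variables (R : realType) (E : banachLatticeType R).
Implicit Types (x y z w : E) (a : R).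

Lemma blat_leD2rE z x y : (x + z <= y + z) = (x <= y).
Proof.
apply/idP/idP => [h|]; last exact: blat_leD2r.
by have := blat_leD2r (- z) _ _ h; rewrite !addrK.
Qed.

Lemma blat_subr_ge0 x y : (0 <= y - x) = (x <= y).
Proof. by rewrite -(blat_leD2rE x 0) add0r subrK. Qed.

Lemma blat_addr_ge0 x y : 0 <= x -> 0 <= y -> 0 <= x + y.
Proof.
move=> x0 y0; apply: (le_trans y0).
by rewrite -{1}[y]add0r blat_leD2rE.
Qed.

Lemma blat_lerD x y z w : x <= y -> z <= w -> x + z <= y + w.
Proof.
move=> xy zw; apply: (@le_trans _ _ (y + z)); first by rewrite blat_leD2rE.
by rewrite ![y + _]addrC blat_leD2rE.
Qed.

Lemma blat_lerN2 x y : (- x <= - y) = (y <= x).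
Proof. by rewrite -(blat_subr_ge0 (- x)) opprK addrC blat_subr_ge0. Qed.

Lemma blat_scaler_ge0 a x : 0 <= a -> 0 <= x -> 0 <= a *: x.
Proof.
by move=> a0 x0; have := blat_leZ2l _ _ _ a0 x0; rewrite scaler0.
Qed.

Lemma blat_scaler_pge0 a x : 0 < a -> (0 <= a *: x) = (0 <= x).
Proof.
move=> a0; apply/idP/idP => [h|]; last by apply: blat_scaler_ge0; exact: ltW.
rewrite -[x]scale1r -(mulVf (lt0r_neq0 a0)) -scalerA.
by apply: blat_scaler_ge0 h; rewrite invr_ge0 ltW.
Qed.

Lemma ler_labs x : x <= labs x. Proof. exact: leUl. Qed.

Lemma lerN_labs x : - x <= labs x. Proof. exact: leUr. Qed.

Lemma labs_ge0 x : 0 <= labs x.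
Proof.
rewrite -(@blat_scaler_pge0 2) // scaler_nat mulr2n -[0](subrr x).
by apply: blat_lerD; [exact: ler_labs|exact: lerN_labs].
Qed.

Lemma labs_id x : 0 <= x -> labs x = x.
Proof.
move=> x0; apply: join_l; apply: (le_trans _ x0).
by rewrite -oppr0 blat_lerN2.
Qed.

Lemma norm_labs x : `|labs x| = `|x|.
Proof.
have h : labs (labs x) = labs x by rewrite labs_id // labs_ge0.
apply/eqP; rewrite eq_le; apply/andP; split; apply: blat_norm_le.
  by change (labs (labs x) <= labs x); rewrite h.
by change (labs x <= labs (labs x)); rewrite h.
Qed.

Lemma blat_ler_norm x y : 0 <= x -> x <= y -> `|x| <= `|y|.
Proof.
move=> x0 xy; apply: blat_norm_le; change (labs x <= labs y).
by rewrite !labs_id // (le_trans x0).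
Qed.

Lemma ler_norm_dominated x y : x <= y -> - x <= y -> `|x| <= `|y|.
Proof.
move=> xy nxy; rewrite -norm_labs; apply: blat_ler_norm (labs_ge0 _) _.
by rewrite /labs leUx xy nxy.
Qed.

Lemma blat_decomp x : exists u v, [/\ 0 <= u, 0 <= v & x = u - v].
Proof.
exists (labs x), (labs x - x); rewrite labs_ge0 blat_subr_ge0 ler_labs.
by rewrite opprB addrC subrK.
Qed.

(** Take [y1] to be the meet of [y] and [u]. Since [y - v] is below both [y] and
    [u], it is below [y1], so the remainder [y - y1] is at most [v]. *)
Lemma riesz_decomposition (u v y : E) :
  0 <= u -> 0 <= v -> 0 <= y -> y <= u + v ->
  exists y1 y2, [/\ 0 <= y1, y1 <= u, 0 <= y2, y2 <= v & y = y1 + y2].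
Proof.
move=> u0 v0 y0 yuv; exists (Order.meet y u), (y - Order.meet y u).
rewrite lexI y0 u0 leIr blat_subr_ge0 leIl.
split=> //; last by rewrite addrC subrK.
rewrite -blat_subr_ge0 opprB addrCA -opprB blat_subr_ge0 lexI.
rewrite -blat_subr_ge0 opprB addrC subrK v0 /=.
by rewrite -(blat_leD2rE v) subrK.
Qed.

(** The negative part of a limit is dominated in norm by its distance to any
    positive element, so the positive cone is closed. *)
Lemma blat_cvg_ge0 (x : nat -> E) (l : E) :
  (\forall n \near \oo, 0 <= x n) -> x @ \oo --> l -> 0 <= l.
Proof.
move=> x0 xl; set m := Order.join (- l) 0.
suff : `|m| <= 0.
  by rewrite normr_le0 => /eqP m0; rewrite -blat_lerN2 oppr0 -m0 leUl.
apply/ler_addgt0Pl => e e0; rewrite addr0.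
have [n [nx ne]] : exists n, 0 <= x n /\ `|l - x n| < e.
  move/cvgrPdist_lt : xl => /(_ e e0) xe.
  by near \oo => n; exists n; split; near: n.
apply: ltW; apply: le_lt_trans ne; rewrite -[leRHS]norm_labs.
apply: blat_ler_norm; first exact: leUr.
rewrite leUx labs_ge0 andbT; apply: le_trans (lerN_labs _).
by rewrite opprB -blat_subr_ge0 opprK subrK.
Unshelve. all: by end_near.
Qed.

End BanachLatticeTheory.

(** * Linear maps and the Riesz-Kantorovich formula *)

Section LinearMaps.
Variables (R : realType) (V W : lmodType R).
Variables (T : V -> W) (linT : linear T).

Lemma linear_add x y : T (x + y) = T x + T y.
Proof. by have := linT 1 x y; rewrite !scale1r. Qed.

Lemma linear_zero : T 0 = 0.
Proof. by apply: (addrI (T 0)); rewrite -linear_add !addr0. Qed.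

Lemma linear_scale a x : T (a *: x) = a *: T x.
Proof. by have := linT a x 0; rewrite linear_zero !addr0. Qed.

Lemma linear_opp x : T (- x) = - T x.
Proof. by rewrite -scaleN1r linear_scale scaleN1r. Qed.

Lemma linear_sub x y : T (x - y) = T x - T y.
Proof. by rewrite linear_add linear_opp. Qed.

End LinearMaps.

Section ConeExtension.
Variables (R : realType) (E : banachLatticeType R) (W : lmodType R).
Variable p : E -> W.
Hypothesis p_add : forall u v : E, 0 <= u -> 0 <= v -> p (u + v) = p u + p v.
Hypothesis p_scale : forall (a : R) (u : E),
  0 < a -> 0 <= u -> p (a *: u) = a *: p u.

(** Kantorovich: [x = labs x - (labs x - x)] is one decomposition into positive
    elements, and additivity makes the value independent of the choice. *)
Lemma cone_extension :
  exists2 P : E -> W, linear P & forall u : E, 0 <= u -> P u = p u.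
Proof.
pose P x := p (labs x) - p (labs x - x).
have PE u v : 0 <= u -> 0 <= v -> P (u - v) = p u - p v.
  move=> u0 v0; rewrite /P; set w := u - v.
  have w0 : 0 <= labs w by exact: labs_ge0.
  have ww0 : 0 <= labs w - w by rewrite blat_subr_ge0 ler_labs.
  apply/eqP; rewrite subr_eq addrAC eq_sym subr_eq -!p_add //.
  by rewrite addrCA opprB [u + _]addrC subrK.
have p0 : p 0 = 0.
  have := p_add (lexx 0) (lexx 0); rewrite addr0 => h.
  by apply: (addrI (p 0)); rewrite addr0 -h.
exists P => [a x y|u u0]; last by rewrite -{1}[u]subr0 PE // p0 subr0.
have [u [v [u0 v0 ->]]] := blat_decomp x.
have [u' [v' [u'0 v'0 ->]]] := blat_decomp y.
rewrite !PE //; have [a0|a0|<-] := ltgtP 0 a; last first.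
- by rewrite !scale0r !add0r PE.
- have na0 : 0 < - a by rewrite oppr_gt0.
  have -> : a *: (u - v) + (u' - v') = (- a *: v + u') - (- a *: u + v').
    by rewrite scalerBr !scaleNr opprD opprK [RHS]addrACA [- _ + _]addrC.
  have v1 := blat_scaler_ge0 (ltW na0) v0.
  have u1 := blat_scaler_ge0 (ltW na0) u0.
  rewrite PE ?blat_addr_ge0 // !p_add // !p_scale //.
  by rewrite scalerBr !scaleNr opprD opprK [LHS]addrACA [- _ + _]addrC.
- have -> : a *: (u - v) + (u' - v') = (a *: u + u') - (a *: v + v').
    by rewrite scalerBr opprD addrACA.
  have v1 := blat_scaler_ge0 (ltW a0) v0.
  have u1 := blat_scaler_ge0 (ltW a0) u0.
  rewrite PE ?blat_addr_ge0 // !p_add // !p_scale //.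
  by rewrite scalerBr opprD addrACA.
Qed.

End ConeExtension.

Section RieszKantorovich.
Variables (R : realType) (E : banachLatticeType R) (W : lmodType R).
Variable le : W -> W -> Prop.
Hypothesis le_anti : forall x y, le x y -> le y x -> x = y.
Hypothesis le_trans : forall x y z, le x y -> le y z -> le x z.
Hypothesis le_add : forall z x y, le x y -> le (x + z) (y + z).
Hypothesis le_scale : forall (a : R) x y,
  0 <= a -> le x y -> le (a *: x) (a *: y).
Variables (T : E -> W) (linT : linear T).

Definition interval_sup (x : E) (s : W) : Prop :=
  (forall y : E, 0 <= y -> y <= x -> le (T y) s) /\
  (forall z, (forall y : E, 0 <= y -> y <= x -> le (T y) z) -> le s z).

Hypothesis sup_ex : forall x : E, 0 <= x -> exists s, interval_sup x s.

(** The supremum is additive in [x] by the Riesz decomposition property of the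
    interval [[0, u + v]], hence extends from the cone to a linear map. The
    order on [W] is an explicit relation so that both the scalars and a
    Banach lattice can serve as target. *)
Lemma riesz_kantorovich :
  exists2 P : E -> W, linear P & forall x : E, 0 <= x -> interval_sup x (P x).
Proof.
have /choice[p pP] : forall x : E, exists s, 0 <= x -> interval_sup x s.
  move=> x; have [x0|x0] := boolP (0 <= x); last by exists 0.
  by have [s sP] := sup_ex x0; exists s.
have le_sub x y z : le (x + y) z -> le x (z - y).
  by move=> h; have := le_add (- y) h; rewrite addrK.
have p_add (u v : E) : 0 <= u -> 0 <= v -> p (u + v) = p u + p v.
  move=> u0 v0; have uv0 := blat_addr_ge0 u0 v0.
  have [uub ulub] := pP _ u0; have [vub vlub] := pP _ v0.
  have [wub wlub] := pP _ uv0.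
  apply: le_anti.
    apply: wlub => y y0 yuv.
    have [y1 [y2 [y10 y1u y20 y2v ->]]] := riesz_decomposition u0 v0 y0 yuv.
    rewrite (linear_add linT); apply: (@le_trans _ (p u + T y2)).
      by apply: le_add; exact: uub.
    by rewrite ![p u + _]addrC; apply: le_add; exact: vub.
  (* Take the supremum over [z <= v] first, then over [y <= u]. *)
  have : le (p u) (p (u + v) - p v).
    apply: ulub => y y0 yu; apply: (le_sub).
    rewrite addrC -[p (u + v)](subrK (T y)).
    apply: le_add; apply: vlub => z z0 zv; apply: (le_sub).
    rewrite -(linear_add linT) addrC.
    by apply: wub; [exact: blat_addr_ge0|exact: blat_lerD].
  by move/(le_add (p v)); rewrite subrK.
have p_scale (a : R) (u : E) : 0 < a -> 0 <= u -> p (a *: u) = a *: p u.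
  move=> a0 u0; have au0 := blat_scaler_ge0 (ltW a0) u0.
  have a0' := lt0r_neq0 a0; have va0 : 0 < a^-1 by rewrite invr_gt0.
  have [uub ulub] := pP _ u0; have [wub wlub] := pP _ au0.
  apply: le_anti.
    apply: wlub => y y0 yu.
    rewrite -[y]scale1r -(mulfV a0') -scalerA (linear_scale linT).
    apply: le_scale (ltW a0) _; apply: uub.
      exact: (blat_scaler_ge0 (ltW va0)).
    rewrite -blat_subr_ge0 -(blat_scaler_pge0 _ a0) scalerBr scalerA mulfV //.
    by rewrite scale1r blat_subr_ge0.
  rewrite -[p (a *: u)]scale1r -(mulfV a0') -scalerA.
  apply: le_scale (ltW a0) _; apply: ulub => y y0 yu.
  rewrite -[y]scale1r -(mulVf a0') -scalerA (linear_scale linT).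
  apply: le_scale (ltW va0) _; apply: wub.
    exact: (blat_scaler_ge0 (ltW a0)).
  rewrite -blat_subr_ge0 -scalerBr; apply: (blat_scaler_ge0 (ltW a0)).
  by rewrite blat_subr_ge0.
have [P linP Pp] := cone_extension p_add p_scale.
by exists P => // x x0; rewrite Pp //; exact: pP.
Qed.

End RieszKantorovich.

(** * Bounded and positive operators *)

Lemma linear_comb (R : realType) (V W : lmodType R) (a : R) (S T : V -> W) :
  linear S -> linear T -> linear (a *: S + T).
Proof.
move=> linS linT b x y; change (a *: S (b *: x + y) + T (b *: x + y) =
  b *: (a *: S x + T x) + (a *: S y + T y)).
rewrite linS linT !scalerDr !scalerA [a * b]mulrC.
by rewrite addrACA.
Qed.

Lemma bounded_operator_comb (R : realType) (V W : normedModType R) (a : R)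
    (S T : V -> W) :
  bounded_operator S -> bounded_operator T -> bounded_operator (a *: S + T).
Proof.
move=> [linS [M SM]] [linT [N TN]]; split; first exact: linear_comb.
exists (`|a| * M + N) => x; change (`|a *: S x + T x| <= (`|a| * M + N) * `|x|).
rewrite mulrDl; apply: le_trans (ler_normD _ _) _.
rewrite lerD // normrZ -mulrA.
by apply: ler_wpM2l.
Qed.

Lemma bounded_operator_comp (R : realType) (U V W : normedModType R)
    (S : V -> W) (T : U -> V) :
  bounded_operator S -> bounded_operator T -> bounded_operator (S \o T).
Proof.
move=> [linS [M SM]] [linT [N TN]]; split.
  by move=> a x y /=; rewrite linT linS.
exists (`|M| * N) => x /=; apply: le_trans (SM _) _.
apply: (@le_trans _ _ (`|M| * `|T x|)); first by rewrite ler_wpM2r // ler_norm.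
by rewrite -mulrA ler_wpM2l.
Qed.

Lemma op_leE (R : realType) (E F : banachLatticeType R) (S T : E -> F) :
  op_le S T <-> forall x, 0 <= x -> S x <= T x.
Proof. by split=> h x x0; have := h x x0; rewrite -blat_subr_ge0. Qed.

Lemma positive_homo (R : realType) (E F : banachLatticeType R) (T : E -> F)
  (x y : E) : linear T -> positive T -> x <= y -> T x <= T y.
Proof.
move=> linT T0 xy; rewrite -blat_subr_ge0 -(linear_sub linT).
by apply: T0; rewrite blat_subr_ge0.
Qed.

Lemma norm_positive_le (R : realType) (E F : banachLatticeType R) (T : E -> F)
  (x : E) : linear T -> positive T -> `|T x| <= `|T (labs x)|.
Proof.
move=> linT T0; apply: ler_norm_dominated.
  by apply: positive_homo => //; exact: ler_labs.
by rewrite -(linear_opp linT); apply: positive_homo => //; exact: lerN_labs.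
Qed.

(** Were [T] unbounded on the cone, there would be [y n >= 0] with
    [`|y n| = 2 ^- n] and [`|T (y n)| > n]; the sum of the [y n] exists by
    completeness and dominates every [y n], which bounds [`|T (y n)|]. *)
Lemma positive_bounded (R : realType) (E F : banachLatticeType R) (T : E -> F) :
  linear T -> positive T -> bounded_operator T.
Proof.
move=> linT T0; split => //.
suff [M TM] : exists M : R, forall x : E, 0 <= x -> `|T x| <= M * `|x|.
  exists M => x; apply: le_trans (norm_positive_le _ linT T0) _.
  by rewrite -[`|x|]norm_labs; apply: TM; exact: labs_ge0.
apply: contrapT => nbd.
have /choice[x xP] : forall n : nat, exists x : E,
    0 <= x /\ n%:R * 2 ^+ n * `|x| < `|T x|.
  move=> n; apply: contrapT => nx; apply: nbd; exists (n%:R * 2 ^+ n) => x x0.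
  by rewrite leNgt; apply/negP => xT; apply: nx; exists x.
have xn0 n : 0 < `|x n|.
  rewrite normr_gt0; apply/eqP => x0; have [_] := xP n.
  by rewrite x0 (linear_zero linT) !normr0 mulr0 ltxx.
pose c n : R := 2^-1 ^+ n / `|x n|.
have c0 n : 0 < c n by rewrite divr_gt0 // exprn_gt0.
pose y n : E := c n *: x n.
have y0 n : 0 <= y n.
  by apply: blat_scaler_ge0; [exact: ltW|have [] := xP n].
have yn n : `|y n| = 2^-1 ^+ n.
  by rewrite normrZ gtr0_norm // mulfVK // gt_eqF.
have Ty n : n%:R < `|T (y n)|.
  rewrite (linear_scale linT) normrZ gtr0_norm // /c.
  have [_ xT] := xP n.
  rewrite mulrAC ltr_pdivlMr // exprVn ltr_pdivlMl ?exprn_gt0 //.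
  by rewrite mulrA [2 ^+ n * _]mulrC.
have cy : cvgn (series y).
  apply: normed_cvg.
  suff -> : [normed series y] = series (geometric 1 2^-1 : R^nat).
    by apply: is_cvg_geometric_series; rewrite gtr0_norm // invf_lt1 // ltr1n.
  apply/funext => k; rewrite /series /=; apply: eq_bigr => i _.
  by rewrite /= yn mul1r.
have yl n : y n <= limn (series y).
  rewrite -blat_subr_ge0.
  apply: (@blat_cvg_ge0 _ _ (fun k => series y k - y n)); last first.
    by apply: cvgB => //; exact: cvg_cst.
  exists n.+1 => // k /= nk.
  rewrite /series /= (bigD1_seq n) ?mem_index_iota ?iota_uniq //=.
  rewrite [y n + _]addrC addrK; apply: (big_ind (fun z : E => 0 <= z)) => //.
  by move=> u v; exact: blat_addr_ge0.
set l := limn _ in yl.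
have [n nl] : exists n : nat, `|T l| < n%:R.
  by exists (Num.truncn `|T l|).+1; exact: truncnS_gt.
have : `|T (y n)| <= `|T l|.
  by apply: blat_ler_norm; [exact: T0|exact: positive_homo].
by rewrite leNgt (lt_trans nl).
Qed.

(** * Order bounded functionals *)

(** Add the values of the nonnegative functionals [g - f] and [g + f] at the
    positive elements [w + z] and [w - z]. *)
Lemma functional_dominated (R : realType) (F : banachLatticeType R)
    (f g : F -> R) (z w : F) :
  linear f -> linear g -> op_le f g -> op_le (- f) g ->
  z <= w -> - z <= w -> `|f z| <= g w.
Proof.
move=> linf ling fg nfg zw nzw.
have wz0 : 0 <= w - z by rewrite blat_subr_ge0.
have wz1 : 0 <= w + z by rewrite -[z]opprK blat_subr_ge0.
move: (fg _ wz0) (fg _ wz1) (nfg _ wz0) (nfg _ wz1).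
change ((0 <= g (w - z) - f (w - z)) -> (0 <= g (w + z) - f (w + z)) ->
  (0 <= g (w - z) - - f (w - z)) -> (0 <= g (w + z) - - f (w + z)) ->
  `|f z| <= g w).
rewrite !(linear_sub linf) !(linear_sub ling).
rewrite !(linear_add linf) !(linear_add ling).
by move=> e1 e2 e3 e4; rewrite ler_norml; apply/andP; split; lra.
Qed.

(** The majorant is the positive part of [f] in the dual. *)
Lemma dual_positive_majorant (R : realType) (F : banachLatticeType R)
    (f : F -> R) : dual f -> exists g, [/\ dual g, positive g & op_le f g].
Proof.
move=> [linf [M fM]].
have fb (x y : F) : 0 <= y -> y <= x -> f y <= `|M| * `|x|.
  move=> y0 yx; apply: le_trans (ler_norm _) _; apply: le_trans (fM _) _.
  apply: (@le_trans _ _ (`|M| * `|y|)); first by rewrite ler_wpM2r // ler_norm.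
  by rewrite ler_wpM2l // blat_ler_norm.
have [||||x x0|g ling gP] := @riesz_kantorovich R F R^o
  (fun a b => (a : R) <= b) _ _ _ _ f linf.
- by move=> x y xy yx; apply/eqP; rewrite eq_le xy yx.
- by move=> x y z; exact: le_trans.
- by move=> z x y xy; rewrite lerD2r.
- by move=> a x y a0 xy; exact: ler_wpM2l.
- pose A := [set f y | y in [set y : F | 0 <= y /\ y <= x]].
  exists (sup A); split => [y y0 yx|z zub].
    apply: ub_le_sup; last by exists y.
    by exists (`|M| * `|x|) => _ [u [u0 ux] <-]; exact: fb.
  apply: ge_sup; first by exists (f 0), 0.
  by move=> _ [u [u0 ux] <-]; exact: zub.
have g0 : positive g.
  move=> x x0; have [ub _] := gP x x0.
  by rewrite -(linear_zero linf); exact: ub.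
exists g; split => //; last first.
  move=> x x0; have [ub _] := gP x x0.
  by change (0 <= g x - f x); rewrite subr_ge0; exact: ub.
split => //; exists `|M| => x.
have [_ lub] := gP _ (labs_ge0 x).
apply: (@le_trans _ _ (g (labs x))); last first.
  by rewrite -[`|x|]norm_labs; apply: lub => y; exact: fb.
apply: functional_dominated => //; [| |exact: ler_labs|exact: lerN_labs].
  by move=> y y0; change (0 <= g y - g y); rewrite subrr.
by move=> y y0; change (0 <= g y - - g y); rewrite opprK addr_ge0 // g0.
Qed.

Lemma dual_order_bounded_majorant (R : realType) (F : banachLatticeType R)
    (f : nat -> F -> R) : dual_order_bounded f ->
  exists g, [/\ dual g, positive g
              & forall n, op_le (f n) g /\ op_le (- f n) g].
Proof.
move=> [_ [g [h [dg dh fgh]]]].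
have dng : dual (- g).
  have -> : - g = -1 *: g + 0 by apply/funext => x; rewrite /= scaleN1r addr0.
  apply: bounded_operator_comb => //; split.
    by move=> a x y; change (0 = a *: 0 + 0 :> R^o); rewrite scaler0 addr0.
  by exists 0 => x; rewrite normr0 mul0r.
have [g' [dg' g'0 gg']] := dual_positive_majorant dng.
have [h' [dh' h'0 hh']] := dual_positive_majorant dh.
(* [h'] dominates [h] and [g'] dominates [- g]. *)
exists (1 *: g' + h'); split => [||n].
- exact: bounded_operator_comb.
- move=> x x0; change (0 <= 1 * g' x + h' x).
  by rewrite mul1r addr_ge0 ?g'0 ?h'0.
have [gf fh] := fgh n; split => x x0.
- change (0 <= 1 * g' x + h' x - f n x).
  have h1 : 0 <= h' x - h x := hh' x x0.
  have h2 : 0 <= h x - f n x := fh x x0.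
  have h3 : 0 <= g' x := g'0 x x0.
  by rewrite mul1r; lra.
- change (0 <= 1 * g' x + h' x - - f n x).
  have h1 : 0 <= g' x - - g x := gg' x x0.
  have h2 : 0 <= f n x - g x := gf x x0.
  have h3 : 0 <= h' x := h'0 x x0.
  by rewrite mul1r; lra.
Qed.

(** * o-MW-operators *)

Lemma bounded_seqP (R : realType) (V : normedModType R) (x : nat -> V) :
  bounded_fun x <-> exists M : R, forall n, `|x n| <= M.
Proof.
split=> [[M [_ xM]]|[M xM]].
  by exists (M + 1) => n; apply: xM => //; rewrite ltrDl.
exists M; split; first exact: num_real.
by move=> N /ltW MN n _; exact: le_trans (xM n) MN.
Qed.

Section oMWTheory.
Variables (R : realType) (E F : banachLatticeType R).
Implicit Types S T : E -> F.

(** For positive operators the o-MW property involves only one positive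
    functional and positive sequences, which makes it inherited by smaller
    positive operators. *)
Definition oMW_on_cone T : Prop :=
  forall (f : F -> R) (x : nat -> E), dual f -> positive f ->
    disjoint_seq x -> bounded_fun x -> (forall n, 0 <= x n) ->
    (fun n => f (T (x n))) @ \oo --> (0 : R).

Lemma oMW_restrict_cone T : oMW T -> oMW_on_cone T.
Proof.
move=> [_ hT] f x df f0 dx bx x0; apply: (hT x (fun=> f)) => //.
split=> //; exists f, f; split => // n.
by split=> y _; change (0 <= f y - f y); rewrite subrr.
Qed.

Lemma oMW_from_cone T :
  linear T -> positive T -> oMW_on_cone T -> oMW T.
Proof.
move=> linT T0 tT; split; first exact: positive_bounded.
move=> x f dx /bounded_seqP[M xM] fb.
have [g [dg g0 fg]] := dual_order_bounded_majorant fb.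
have lim : (fun n => g (T (labs (x n)))) @ \oo --> (0 : R).
  apply: (tT g (fun n => labs (x n))) => //.
  - by move=> n m nm; rewrite !(labs_id (labs_ge0 _)); exact: dx.
  - by apply/bounded_seqP; exists M => n; rewrite norm_labs.
  - by move=> n; exact: labs_ge0.
apply/norm_cvg0P; apply: (squeeze_cvgr _ (cvg_cst 0) lim).
apply: nearW => n; rewrite normr_ge0 /=.
have [fgn nfgn] := fg n; have [dfn _] := fb.
apply: functional_dominated => //; [exact: (dfn n).1|exact: dg.1| |].
  by apply: positive_homo => //; exact: ler_labs.
by rewrite -(linear_opp linT); apply: positive_homo => //; exact: lerN_labs.
Qed.

(** [0 <= f (S (x n)) <= f (T (x n))] on positive sequences. *)
Lemma oMW_domination S T :
  linear S -> positive S -> op_le S T -> oMW T -> oMW S.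
Proof.
move=> linS S0 /op_leE ST /oMW_restrict_cone tT.
apply: oMW_from_cone => // f x df f0 dx bx x0.
apply: (squeeze_cvgr _ (cvg_cst 0) (tT f x df f0 dx bx x0)).
apply: nearW => n; apply/andP; split; first by apply: f0; exact: S0.
rewrite -subr_ge0 -(linear_sub df.1); apply: f0.
by rewrite blat_subr_ge0; exact: ST.
Qed.

Lemma oMW_comb (a : R) S T : oMW S -> oMW T -> oMW (a *: S + T).
Proof.
move=> [bS hS] [bT hT]; split; first exact: bounded_operator_comb.
move=> x f dx bx fb.
have -> : (fun n => f n ((a *: S + T) (x n))) =
          (fun n => a * f n (S (x n)) + f n (T (x n))).
  by apply/funext => n; have [df _] := fb; exact: ((df n).1 a).
rewrite -[0 in X in _ --> X](addr0 0) -[X in _ --> X + _](mulr0 a).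
by apply: cvgD; [apply: cvgMl_tmp; exact: hS|exact: hT].
Qed.

Lemma oMW_zero : oMW (0 : E -> F).
Proof.
split; first split.
- by move=> a x y; change (0 = a *: 0 + 0 :> F); rewrite scaler0 addr0.
- by exists 0 => x; change (`|0 : F| <= 0 * `|x|); rewrite normr0 mul0r.
move=> x f _ _ [df _].
have -> : (fun n => f n ((0 : E -> F) (x n))) = cst 0.
  by apply/funext => n; exact: (linear_zero (df n).1).
exact: cvg_cst.
Qed.

Lemma oMW_add S T : oMW S -> oMW T -> oMW (S + T).
Proof. by move=> ? ?; rewrite -[S]scale1r; exact: oMW_comb. Qed.

End oMWTheory.

(** The adjoint of the positive operator [S] maps order bounded sequences of
    functionals to order bounded ones. *)
Lemma oMW_comp (R : realType) (E F G : banachLatticeType R) (S : F -> G)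
    (T : E -> F) : linear S -> positive S -> oMW T -> oMW (S \o T).
Proof.
move=> linS S0 [bT hT]; have bS := positive_bounded linS S0.
split; first exact: bounded_operator_comp.
move=> x f dx bx [df [g [h [dg dh fgh]]]].
apply: (hT x (fun n => f n \o S)) => //; split.
  by move=> n; exact: (bounded_operator_comp (df n) bS).
exists (g \o S), (h \o S); split.
- exact: (bounded_operator_comp dg bS).
- exact: (bounded_operator_comp dh bS).
move=> n; have [gf fh] := fgh n.
by split=> y /S0; [exact: gf|exact: fh].
Qed.

(** * Regular and regularly o-MW-operators *)

Section OperatorsOnE.
Variables (R : realType) (E : banachLatticeType R).
Implicit Types S T M U : E -> E.

Lemma linear_fctD S T : linear S -> linear T -> linear (S + T).
Proof. by move=> ? ?; rewrite -[S]scale1r; exact: linear_comb. Qed.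

Lemma linear_fctB S T : linear S -> linear T -> linear (S - T).
Proof.
by move=> ? ?; rewrite addrC -scaleN1r; exact: linear_comb.
Qed.

Lemma positiveD S T : positive S -> positive T -> positive (S + T).
Proof. by move=> S0 T0 x x0; exact: (blat_addr_ge0 (S0 x x0) (T0 x x0)). Qed.

Lemma positiveZ (a : R) T : 0 <= a -> positive T -> positive (a *: T).
Proof. by move=> a0 T0 x x0; exact: (blat_scaler_ge0 a0 (T0 x x0)). Qed.

Lemma op_le_trans T S U : op_le S T -> op_le T U -> op_le S U.
Proof.
move=> /op_leE ST /op_leE TU; apply/op_leE => x x0.
exact: le_trans (ST x x0) (TU x x0).
Qed.

Lemma Lr_linear T : Lr E T -> linear T.
Proof. by move=> [T1 [T2 [l1 l2 _ _ ->]]]; exact: linear_fctB. Qed.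

Lemma Lr_positive T : linear T -> positive T -> Lr E T.
Proof.
move=> linT T0; exists T, 0; split => //; last by rewrite subr0.
by move=> a x y; change (0 = a *: 0 + 0 :> E); rewrite scaler0 addr0.
Qed.

(** Covers both [Lr E], with [B] the linear maps, and [roMW E], with [B] the
    o-MW-operators. A negative scalar exchanges the two positive parts. *)
Lemma positive_difference_comb (B : set (E -> E)) (a : R) S T :
  (forall b S' T', B S' -> B T' -> B (b *: S' + T')) ->
  (exists T1 T2, [/\ B T1, B T2, positive T1, positive T2 & S = T1 - T2]) ->
  (exists T1 T2, [/\ B T1, B T2, positive T1, positive T2 & T = T1 - T2]) ->
  exists T1 T2, [/\ B T1, B T2, positive T1, positive T2
                  & a *: S + T = T1 - T2].
Proof.
move=> Bcomb [S1 [S2 [lS1 lS2 S10 S20 ->]]] [T1 [T2 [lT1 lT2 T10 T20 ->]]].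
have [a0|/ltW a0] := leP 0 a.
  exists (a *: S1 + T1), (a *: S2 + T2); split.
  - exact: Bcomb.
  - exact: Bcomb.
  - by apply: positiveD => //; exact: positiveZ.
  - by apply: positiveD => //; exact: positiveZ.
  - by rewrite scalerBr opprD addrACA.
have na0 : 0 <= - a by rewrite oppr_ge0.
exists (- a *: S2 + T1), (- a *: S1 + T2); split.
- exact: Bcomb.
- exact: Bcomb.
- by apply: positiveD => //; exact: positiveZ.
- by apply: positiveD => //; exact: positiveZ.
- by rewrite scalerBr !scaleNr opprD opprK [RHS]addrACA [- _ + _]addrC.
Qed.

Lemma Lr_comb (a : R) S T : Lr E S -> Lr E T -> Lr E (a *: S + T).
Proof.
apply: (positive_difference_comb (B := [set T' : E -> E | linear T'])).
move=> b S' T'.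
exact: linear_comb.
Qed.

Lemma LrB S T : Lr E S -> Lr E T -> Lr E (S - T).
Proof. by move=> ? ?; rewrite addrC -scaleN1r; exact: Lr_comb. Qed.

Lemma LrD S T : Lr E S -> Lr E T -> Lr E (S + T).
Proof. by move=> ? ?; rewrite -[S]scale1r; exact: Lr_comb. Qed.

Lemma roMW_Lr : roMW E `<=` Lr E.
Proof.
move=> _ [T1 [T2 [oT1 oT2 p1 p2 ->]]].
by exists T1, T2; split => //; [exact: oT1.1.1|exact: oT2.1.1].
Qed.

Lemma roMW_comb (a : R) S T : roMW E S -> roMW E T -> roMW E (a *: S + T).
Proof.
apply: (positive_difference_comb (B := @oMW R E E)) => b S' T'.
exact: oMW_comb.
Qed.

Lemma roMW_positive T : oMW T -> positive T -> roMW E T.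
Proof.
move=> oT T0; exists T, 0; split => //; last by rewrite subr0.
exact: oMW_zero.
Qed.

Lemma roMWB S T : roMW E S -> roMW E T -> roMW E (S - T).
Proof. by move=> ? ?; rewrite addrC -scaleN1r; exact: roMW_comb. Qed.

Lemma roMWD S T : roMW E S -> roMW E T -> roMW E (S + T).
Proof. by move=> ? ?; rewrite -[S]scale1r; exact: roMW_comb. Qed.

Lemma roMW_oMW : roMW E `<=` @oMW R E E.
Proof.
move=> T [T1 [T2 [oT1 oT2 _ _ ->]]].
by rewrite addrC -scaleN1r; exact: oMW_comb.
Qed.

Lemma roMW_subspace : subspace_of (Lr E) (roMW E).
Proof.
split; [exact: roMW_Lr| |exact: roMW_comb].
by apply: roMW_positive => //; exact: oMW_zero.
Qed.

Lemma roMW_subalgebra : subalgebra_of (Lr E) (roMW E).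
Proof.
split; first exact: roMW_subspace.
move=> _ _ [S1 [S2 [oS1 oS2 S10 S20 ->]]] [T1 [T2 [oT1 oT2 T10 T20 ->]]].
have lS1 := oS1.1.1; have lS2 := oS2.1.1.
have comp_pos (A B : E -> E) : positive A -> positive B -> positive (A \o B).
  by move=> A0 B0 x /B0 /A0.
exists ((S1 \o T1) + (S2 \o T2)), ((S1 \o T2) + (S2 \o T1)); split.
- by apply: oMW_add; exact: oMW_comp.
- by apply: oMW_add; exact: oMW_comp.
- by apply: positiveD; exact: comp_pos.
- by apply: positiveD; exact: comp_pos.
apply/funext => x.
change (S1 (T1 x - T2 x) - S2 (T1 x - T2 x) =
        (S1 (T1 x) + S2 (T2 x)) - (S1 (T2 x) + S2 (T1 x))).
rewrite (linear_sub lS1) (linear_sub lS2) !opprD opprK !addrA.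
by rewrite -!addrA; congr (_ + _); rewrite [RHS]addrC -!addrA; congr (_ + _).
Qed.

(** If every regular operator is regularly o-MW, then in particular the
    identity is a difference of o-MW-operators; conversely a positive operator
    [T1] is [T1 \o idfun]. *)
Lemma roMW_eq_LrP : roMW E = Lr E <-> oMW (idfun : E -> E).
Proof.
split => [eqE|oI].
  by apply: roMW_oMW; rewrite eqE; apply: Lr_positive.
apply/seteqP; split; first exact: roMW_Lr.
move=> _ [T1 [T2 [l1 l2 p1 p2 ->]]]; exists T1, T2; split=> //.
- exact: (oMW_comp l1 p1 oI).
- exact: (oMW_comp l2 p2 oI).
Qed.

End OperatorsOnE.

(** * Approximation in operator norm *)

Section OperatorNorm.
Variables (R : realType) (V W : normedModType R).
Variables (T : V -> W) (bT : bounded_operator T).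

Lemma opnorm_has_ubound : has_ubound [set `|T x| | x in [set x | `|x| <= 1]].
Proof.
have [_ [M TM]] := bT; exists `|M| => _ [x x1 <-].
apply: le_trans (TM x) _; apply: le_trans (ler_norm _) _.
by rewrite normrM normr_id ler_piMr.
Qed.

Lemma le_opnorm x : `|x| <= 1 -> `|T x| <= opnorm T.
Proof. by move=> x1; apply: ub_le_sup opnorm_has_ubound _ _; exists x. Qed.

Lemma opnorm_ge0 : 0 <= opnorm T.
Proof. by apply: le_trans (@le_opnorm 0 _); rewrite ?normr0. Qed.

Lemma le_opnormM x : `|T x| <= opnorm T * `|x|.
Proof.
have linT := bT.1.
have [->|x0] := eqVneq x 0; first by rewrite (linear_zero linT) !normr0 mulr0.
have nx : 0 < `|x| by rewrite normr_gt0.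
rewrite -ler_pdivrMr // mulrC -[X in X * _]gtr0_norm ?invr_gt0 //.
rewrite -normrZ -(linear_scale linT); apply: le_opnorm.
by rewrite normrZ gtr0_norm ?invr_gt0 // mulVf // gt_eqF.
Qed.

End OperatorNorm.

Lemma opnorm_homo (R : realType) (E F : banachLatticeType R) (S T : E -> F) :
  linear S -> linear T -> positive S -> op_le S T -> opnorm S <= opnorm T.
Proof.
move=> linS linT S0 /op_leE ST.
have T0 : positive T by move=> x x0; exact: le_trans (S0 x x0) (ST x x0).
apply: ge_sup; first by exists `|S 0|, 0 => //=; rewrite normr0.
move=> _ [x x1 <-]; apply: le_trans (norm_positive_le _ linS S0) _.
apply: (@le_trans _ _ `|T (labs x)|).
  by apply: blat_ler_norm; [apply: S0|apply: ST]; exact: labs_ge0.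
by apply: le_opnorm; [exact: positive_bounded|rewrite norm_labs].
Qed.

(** For a fixed functional and a bounded sequence, the error term [U] costs at
    most a constant times [opnorm U]. *)
Lemma oMW_approx (R : realType) (E F : banachLatticeType R) (P : E -> F) :
  linear P -> positive P ->
  (forall e : R, 0 < e -> exists Q U : E -> F,
     [/\ oMW Q, bounded_operator U, op_le P (Q + U) & opnorm U < e]) ->
  oMW P.
Proof.
move=> linP P0 apx; apply: oMW_from_cone => // f x df f0 dx bx x0.
have [M xM] := (bounded_seqP x).1 bx.
have [linf [C fC]] := df.
have M0 : 0 <= M by apply: le_trans (xM 0%N).
apply/cvgr0Pnorm_le => e e0.
(* [K] bounds the norm of [f] times that of [x n]; the [+ 1] keeps it
   invertible. *)
pose K := (`|C| + 1) * (M + 1).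
have K0 : 0 < K by rewrite mulr_gt0 // ltr_wpDl.
(* Half of [e] is spent on [f (U (x n))], half on [f (Q (x n))]. *)
have [|Q [U [oQ bU PQU Ue]]] := apx (e / 2 / K); first by rewrite !divr_gt0.
have /cvgr0Pnorm_le/(_ (e / 2)) := oMW_restrict_cone oQ df f0 dx bx x0.
rewrite divr_gt0 // => /(_ isT); apply: filterS => n fQ.
have h1 : 0 <= f (P (x n)) by apply: f0; exact: P0.
have h2 : f (P (x n)) <= f (Q (x n)) + f (U (x n)).
  rewrite -(linear_add linf) -subr_ge0 -(linear_sub linf).
  by apply: f0; exact: PQU.
have h3 : f (U (x n)) <= e / 2.
  apply: le_trans (ler_norm _) _; apply: le_trans (fC _) _.
  apply: (@le_trans _ _ ((`|C| + 1) * `|U (x n)|)).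
    by rewrite ler_wpM2r // (le_trans (ler_norm _)) // lerDl.
  apply: (@le_trans _ _ ((`|C| + 1) * (e / 2 / K * (M + 1)))); last first.
    by rewrite mulrCA -/K mulfVK // gt_eqF.
  rewrite ler_wpM2l ?addr_ge0 //; apply: le_trans (le_opnormM bU _) _.
  apply: ler_pM => //; [exact: opnorm_ge0|exact: ltW|].
  by rewrite (le_trans (xM n)) // lerDl.
rewrite ger0_norm // (le_trans h2) // [leRHS]splitr lerD //.
by rewrite (le_trans (ler_norm _)).
Qed.

(** * Lattice structure *)

Section DedekindComplete.
Variables (R : realType) (E : banachLatticeType R).
Implicit Types S T M U P N : E -> E.

Lemma LrN T : Lr E T -> Lr E (- T).
Proof.
by move=> [T1 [T2 [l1 l2 p1 p2 ->]]]; exists T2, T1; rewrite opprB.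
Qed.

(** Adding the two inequalities gives [0 <= 2 U]. *)
Lemma dominator_positive T U : op_le T U -> op_le (- T) U -> positive U.
Proof.
move=> TU nTU x x0; rewrite -(@blat_scaler_pge0 _ _ 2) // scaler_nat mulr2n.
have h1 : 0 <= U x - T x := TU x x0.
have h2 : 0 <= U x - - T x := nTU x x0.
by have := blat_addr_ge0 h1 h2; rewrite opprK addrACA addNr addr0.
Qed.

Lemma dominated_roMW M P :
  linear M -> positive M -> op_le M P -> oMW P -> roMW E M.
Proof.
move=> linM M0 MP oP; apply: roMW_positive => //.
exact: oMW_domination MP oP.
Qed.

(** Write [S = S1 - S2] and [T = T1 - T2]. As [S1 + T1] is an upper bound of [S]
    and [T], [0 <= M - S <= S1 + T1 - S = T1 + S2], so domination applies to
    [M - S]. *)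
Lemma join_roMW S T M :
  roMW E S -> roMW E T -> is_join_in (Lr E) S T M -> roMW E M.
Proof.
move=> rS rT [LM SM TM Mlub].
have LS := roMW_Lr rS.
have [S1 [S2 [oS1 oS2 S10 S20 eS]]] := rS.
have [T1 [T2 [oT1 oT2 T10 T20 eT]]] := rT.
have LU : Lr E (S1 + T1) by apply: roMW_Lr; apply: roMWD; exact: roMW_positive.
have MU : op_le M (S1 + T1).
  apply: Mlub => //; rewrite /op_le.
    have -> : S1 + T1 - S = T1 + S2.
      by rewrite eS opprB [S2 - _]addrC addrACA subrr add0r.
    exact: positiveD.
  have -> : S1 + T1 - T = S1 + T2 by rewrite eT opprB [T2 - _]addrC addrA addrK.
  exact: positiveD.
rewrite -(subrK S M); apply: roMWD rS.
apply: (@dominated_roMW _ (T1 + S2)) => //.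
- by apply: linear_fctB; exact: Lr_linear.
- rewrite /op_le.
  have -> : T1 + S2 - (M - S) = S1 + T1 - M.
    by rewrite opprB eS addrA [S1 - _]addrC addrA addrK [T1 + _]addrC.
  exact: MU.
- exact: oMW_add.
Qed.

(** Dually, [- (S2 + T2)] is a lower bound, so [0 <= S - M <= S1 + T2]. *)
Lemma meet_roMW S T M :
  roMW E S -> roMW E T -> is_meet_in (Lr E) S T M -> roMW E M.
Proof.
move=> rS rT [LM SM TM Mglb].
have LS := roMW_Lr rS.
have [S1 [S2 [oS1 oS2 S10 S20 eS]]] := rS.
have [T1 [T2 [oT1 oT2 T10 T20 eT]]] := rT.
have LU : Lr E (- (S2 + T2)).
  by apply: LrN; apply: roMW_Lr; apply: roMWD; exact: roMW_positive.
have UM : op_le (- (S2 + T2)) M.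
  apply: Mglb => //; rewrite /op_le opprK.
    have -> : S + (S2 + T2) = S1 + T2 by rewrite eS addrA subrK.
    exact: positiveD.
  have -> : T + (S2 + T2) = T1 + S2 by rewrite eT [S2 + _]addrC addrA subrK.
  exact: positiveD.
rewrite -(subKr S M); apply: roMWB rS _.
apply: (@dominated_roMW _ (S1 + T2)) => //.
- by apply: linear_fctB; exact: Lr_linear.
- rewrite /op_le.
  have -> : S1 + T2 - (S - M) = M - - (S2 + T2).
    rewrite opprK opprB {1}eS opprB addrCA [S2 - _]addrC addrACA subrr add0r.
    by rewrite [T2 + _]addrC.
  exact: UM.
- exact: oMW_add.
Qed.

(** With [P = T1 + T2] the hypotheses give [- P <= S <= P], hence
    [0 <= P - S <= 2 P], and [S = P - (P - S)]. *)
Lemma roMW_dominated S T MS MT : Lr E S -> roMW E T ->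
  is_modulus_in (Lr E) S MS -> is_modulus_in (Lr E) T MT -> op_le MS MT ->
  roMW E S.
Proof.
move=> LS rT [_ SMS nSMS _] [_ _ _ MTlub] MST.
have [T1 [T2 [oT1 oT2 T10 T20 eT]]] := rT.
have oP := oMW_add oT1 oT2; have P0 := positiveD T10 T20.
set P := T1 + T2 in oP P0.
have rP : roMW E P by exact: roMW_positive.
have MTP : op_le MT P.
  apply: MTlub; first exact: roMW_Lr; rewrite /op_le.
    have -> : P - T = T2 + T2.
      by rewrite eT opprB [T2 - _]addrC addrACA subrr add0r.
    exact: positiveD.
  have -> : P - - T = T1 + T1 by rewrite opprK eT addrACA subrr addr0.
  exact: positiveD.
have SP := op_le_trans SMS (op_le_trans MST MTP).
have nSP := op_le_trans nSMS (op_le_trans MST MTP).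
rewrite -(subKr P S); apply: roMWB rP _.
apply: (@dominated_roMW _ (P + P)) => //.
- by apply: linear_fctB; [exact: oP.1.1|exact: Lr_linear].
- rewrite /op_le; have -> : P + P - (P - S) = P - - S.
    by rewrite opprB opprK [S - _]addrC addrA addrK.
  exact: nSP.
- exact: oMW_add.
Qed.

Hypothesis dcE : dedekind_complete E.

(** The Riesz-Kantorovich formula: the positive part of [T = T1 - T2] at
    [x >= 0] is the supremum of [T y] over [0 <= y <= x], a set bounded above
    by [T1 x]. *)
Lemma Lr_parts T : Lr E T -> exists P N,
  [/\ T = P - N, linear P /\ linear N, positive P /\ positive N,
      forall U, linear U -> positive U -> op_le T U -> op_le P U
    & forall U, linear U -> positive U -> op_le (- T) U -> op_le N U].
Proof.
move=> LT; have linT := Lr_linear LT.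
have [T1 [T2 [l1 l2 T10 T20 eT]]] := LT.
have TT1 y : 0 <= y -> T y <= T1 y.
  move=> y0; rewrite -blat_subr_ge0 eT.
  by change (0 <= T1 y - (T1 y - T2 y)); rewrite subKr; exact: T20.
have [||||x x0|P linP PP] := @riesz_kantorovich R E E
  (fun a b => (a : E) <= b) _ _ _ _ T linT.
- by move=> x y xy yx; apply/eqP; rewrite eq_le xy yx.
- by move=> x y z; exact: le_trans.
- by move=> z x y xy; rewrite blat_leD2rE.
- by move=> a x y a0; exact: blat_leZ2l.
- pose A := [set T y | y in [set y : E | 0 <= y /\ y <= x]].
  have [|s [sub slub]] := dcE (A := A).
    split; first by exists (T 0), 0.
    exists (T1 x) => _ [y [y0 yx] <-]; apply: le_trans (TT1 _ y0) _.
    exact: positive_homo.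
  exists s; split => [y y0 yx|z zub]; first by apply: sub; exists y.
  by apply: slub => _ [y [y0 yx] <-]; exact: zub.
have P0 : positive P.
  move=> x x0; have [ub _] := PP x x0.
  by rewrite -(linear_zero linT); exact: ub.
have TP : op_le T P.
  by apply/op_leE => x x0; have [ub _] := PP x x0; exact: ub.
have Pleast U : linear U -> positive U -> op_le T U -> op_le P U.
  move=> linU U0 /op_leE TU; apply/op_leE => x x0; have [_ lub] := PP x x0.
  apply: lub => y y0 yx; apply: le_trans (TU y y0) _.
  exact: positive_homo.
exists P, (P - T); split => //.
- by rewrite subKr.
- by split=> //; exact: linear_fctB.
- move=> U linU U0; rewrite /op_le opprK => TU.
  rewrite opprB addrA; apply: Pleast => //; first exact: linear_fctD.
  by rewrite /op_le addrK.
Qed.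

(** With [P] the positive part of [S - T], the join is [T + P] and the meet is
    [S - P]. *)
Lemma Lr_lattice_ordered : lattice_ordered (Lr E).
Proof.
move=> S T LS LT.
have linS := Lr_linear LS; have linT := Lr_linear LT.
have [P [N [eP [linP linN] [P0 N0] Pleast _]]] := Lr_parts (LrB LS LT).
have LP : Lr E P by exact: Lr_positive.
have STP : positive (P - (S - T)) by rewrite eP subKr.
split.
  exists (T + P); split.
  - exact: LrD.
  - by rewrite /op_le addrAC addrC -[T - S]opprB.
  - by rewrite /op_le addrAC subrr add0r.
  move=> U LU SU TU; rewrite /op_le opprD addrA; apply: Pleast => //.
    by apply: linear_fctB => //; exact: Lr_linear.
  by rewrite /op_le opprB addrA subrK.
exists (S - P); split.
- exact: LrB.
- by rewrite /op_le subKr.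
- by rewrite /op_le opprB addrCA -[T - S]opprB.
move=> U LU US UT; rewrite /op_le addrAC; apply: Pleast => //.
  by apply: linear_fctB => //; exact: Lr_linear.
by rewrite /op_le opprB [S - U + _]addrC addrA subrK.
Qed.

Lemma roMW_sublattice : sublattice_of (Lr E) (roMW E).
Proof.
split; first exact: Lr_lattice_ordered.
by move=> S T M rS rT [|]; [exact: join_roMW|exact: meet_roMW].
Qed.

(** The decomposition [S = S1 - S2] of an approximant changes with the
    precision, so it is the two fixed parts of [T] that are shown to be o-MW,
    each being dominated up to an operator [U] of small norm. *)
Lemma roMW_closed : norm_closed_in (Lr E) (@r_norm R E) (roMW E).
Proof.
move=> T LT cT.
have [P [N [eT [linP linN] [P0 N0] Pleast Nleast]]] := Lr_parts LT.
have apx e : 0 < e -> exists S1 S2 U,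
    [/\ oMW S1 /\ oMW S2, positive S1 /\ positive S2,
    linear U /\ positive U, opnorm U < e
    & op_le T (S1 + U) /\ op_le (- T) (S2 + U)].
  move=> e0; have [S rS TSe] := cT e e0.
  have [S1 [S2 [oS1 oS2 S10 S20 eS]]] := rS.
  have [A [B [lA lB A0 B0 eAB]]] := LrB LT (roMW_Lr rS).
  (* [A + B] dominates [T - S], so the infimum is over a nonempty set. *)
  have := inf_lt _ TSe; case.
    exists (opnorm (A + B)), (A + B) => //; split.
    - by apply: LrD; exact: Lr_positive.
    - rewrite eAB /op_le opprB [B - _]addrC addrACA subrr add0r.
      exact: positiveD.
    - rewrite eAB /op_le opprK addrACA subrr addr0.
      exact: positiveD.
  move=> _ [U [LU TSU nTSU] <-] Ue; exists S1, S2, U; split => //.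
    by split; [exact: Lr_linear|exact: dominator_positive nTSU].
  split; rewrite /op_le.
    have -> : S1 + U - T = S2 + (U - (T - S)).
      rewrite opprB eS addrCA [S1 - S2 - T]addrAC [S2 + _]addrC subrK.
      by rewrite addrCA addrA.
    exact: positiveD.
  have -> : S2 + U - - T = S1 + (U - - (T - S)).
    by rewrite !opprK eS opprB [RHS]addrC !addrA subrK -[LHS]addrA addrC.
  exact: positiveD.
rewrite eT; apply: roMWB.
  apply: roMW_positive => //; apply: oMW_approx => // e e0.
  have [S1 [S2 [U [[oS1 oS2] [S10 S20] [lU U0] Ue [TU nTU]]]]] := apx e e0.
  exists S1, U; split => //; first exact: positive_bounded.
  apply: Pleast => //; last exact: positiveD.
  by apply: linear_fctD => //; exact: oS1.1.1.
apply: roMW_positive => //; apply: oMW_approx => // e e0.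
have [S1 [S2 [U [[oS1 oS2] [S10 S20] [lU U0] Ue [TU nTU]]]]] := apx e e0.
exists S2, U; split => //; first exact: positive_bounded.
apply: Nleast => //; last exact: positiveD.
by apply: linear_fctD => //; exact: oS2.1.1.
Qed.

(** The modulus of [T] is an o-MW-operator and has the least norm among all
    regular dominators, so both infima are attained there. *)
Lemma roMW_norm_r_norm T : roMW E T -> roMW_norm T = r_norm T.
Proof.
move=> rT; have LT := roMW_Lr rT.
have [[M TM] _] := Lr_lattice_ordered LT (LrN LT).
have rM : roMW E M.
  apply: (join_roMW rT _ TM); rewrite -sub0r; apply: roMWB rT.
  by case: (roMW_subspace E).
have [LM TM1 TM2 Mlub] := TM.
have M0 := dominator_positive TM1 TM2.
have norm_ge B S : (forall S, B S -> linear S) ->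
    [set S | [/\ B S, op_le T S & op_le (- T) S]] S -> opnorm M <= opnorm S.
  move=> Blin [BS TS nTS].
  apply: opnorm_homo => //; [exact: Lr_linear|exact: Blin|].
  apply: Mlub => //; apply: Lr_positive; first exact: Blin.
  exact: dominator_positive nTS.
have dom_norm B : (forall S, B S -> linear S) -> B M ->
    dominated_norm B T = opnorm M.
  move=> Blin BM; apply/eqP; rewrite eq_le; apply/andP; split.
    apply: ge_inf; last by exists M.
    by exists (opnorm M) => _ [S BS <-]; exact: norm_ge BS.
  apply: lb_le_inf; first by exists (opnorm M), M.
  by move=> _ [S BS <-]; exact: norm_ge BS.
rewrite /roMW_norm /r_norm !dom_norm //.
- by move=> S; exact: Lr_linear.
- by move=> S [[]].
- exact: roMW_oMW.
Qed.

End DedekindComplete.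

Unset Implicit Arguments.

Theorem theorem3p4p6 (R : realType) (E : banachLatticeType R) :
  (subalgebra_of (Lr E) (roMW E) /\
   (roMW E = Lr E <-> oMW (idfun : E -> E))) /\
  (dedekind_complete E ->
   [/\ riesz_subalgebra_of (Lr E) (roMW E),
       order_ideal_of (Lr E) (roMW E),
       norm_closed_in (Lr E) (@r_norm R E) (roMW E)
     & forall T, roMW E T -> roMW_norm T = r_norm T]).
Proof.
split.
  by split; [exact: roMW_subalgebra|exact: roMW_eq_LrP].
move=> dcE; split.
- by split; [exact: roMW_subalgebra|exact: roMW_sublattice].
- split; [exact: Lr_lattice_ordered|exact: roMW_subspace|].
  by move=> S T MS MT; exact: roMW_dominated.
- exact: roMW_closed.
- by move=> T; exact: roMW_norm_r_norm.
Qed.
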